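(* Let $n\ge 3$ be an integer and $s\in\{0,2,3,4\}$. Then the arc set of $\overrightarrow{C}_{(4:n)}$ can be partitioned into $s$ $\overrightarrow{C}_{2n}$-factors and $4-s$ $\overrightarrow{C}_n$-factors.
   Context: For positive integers $x$ and $k\ge 3$, $\overrightarrow{C}_{(x:k)}$ is the directed graph with vertex set $\{(g,i):0\le g\le x-1,\ i\in\mathbb{Z}_k\}$ and arcs $((g,i),(h,i+1))$ for all $g,h$ and $i\in\mathbb{Z}_k$. A $\overrightarrow{C}_\ell$-factor is a spanning subgraph each of whose components is a directed cycle of length $\ell$. *)

(* Defs.v *)
From mathcomp Require Import all_boot.

Set Implicit Arguments.
Unset Strict Implicit.
Unset Printing Implicit Defensive.

Section Digraph.

Variable T : finType.

(* A digraph on T is a relation [e : rel T]; a spanning subgraph of it is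
   identified with its arc set [F : {set T * T}]. *)
Definition arcs (e : rel T) : {set T * T} := [set a | e a.1 a.2].

Definition adjacent (F : {set T * T}) : rel T :=
  fun x y => ((x, y) \in F) || ((y, x) \in F).

(* Components are those of the underlying undirected graph. *)
Definition component_verts (F : {set T * T}) (x : T) : {set T} :=
  [set y | connect (adjacent F) x y].

Definition component_arcs (F : {set T * T}) (x : T) : {set T * T} :=
  [set a in F | (a.1 \in component_verts F x) && (a.2 \in component_verts F x)].

(* The digraph with vertex set V and arc set A is a directed cycle of length
   l: V lists as c_0, ..., c_(l-1) without repetition and A consists of the
   arcs (c_i, c_(i+1)), indices mod l. *)
Definition is_dicycle (l : nat) (V : {set T}) (A : {set T * T}) : Prop :=
  exists c : seq T,
    [/\ uniq c, size c = l, V = [set x in c]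
      & A = [set (x, next c x) | x in c]].

Definition dicycle_factor (e : rel T) (l : nat) (F : {set T * T}) : Prop :=
  F \subset arcs e /\
  forall x : T, is_dicycle l (component_verts F x) (component_arcs F x).

End Digraph.

(* The index set Z_k is 'I_k with the cyclic successor [ordS]. *)
Definition blowup_cycle (x k : nat) : rel ('I_x * 'I_k) :=
  fun u v => v.2 == ordS u.2.
Arguments blowup_cycle : clear implicits.

(* Main.v *)
(* Identify the four vertices of each layer with V = (Z/2)^2.  For each v in V,
   let F_v be the permutation digraph whose arcs out of layer i translate by
   a v i, where v |-> a v i permutes V for every i.  The F_v then partition the
   arcs, and going once around the cycle translates by b v = \sum_i a v i, so
   all cycles of F_v have length n if b v = 0 and 2n otherwise.  Taking
   a v i = v for i >= 2, where equal layers cancel in pairs, the first two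
   layers can be chosen so that b is, up to a permutation of V, v + u v for
   some permutation u; suitable u make this nonzero 0, 2, 3 or 4 times. *)
Require Import Defs.
From mathcomp Require Import all_boot all_algebra.
Set Implicit Arguments.
Unset Strict Implicit.
Unset Printing Implicit Defensive.
Import GRing.Theory.

(** * Permutation digraphs and their cycles *)

Definition fgraph_arcs (T : finType) (f : T -> T) : {set T * T} :=
  [set (x, f x) | x in T].

Lemma in_fgraph_arcs (T : finType) (f : T -> T) x y :
  ((x, y) \in fgraph_arcs f) = (y == f x).
Proof.
apply/imsetP/eqP => [[z _ [-> ->]] //| ->]; by exists x.
Qed.

(** The first [m] iterates form a closed [f]-path through [x], which bounds the order by [m];
    returning to [x] after [order f x] steps makes it a multiple of [m]. *)
Lemma order_eq (T : finType) (f : T -> T) (x : T) m :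
  injective f -> 0 < m -> (forall k, (iter k f x == x) = (m %| k)) ->
  order f x = m.
Proof.
move=> f_inj m_gt0 iter_eq; apply/eqP; rewrite eqn_leq; apply/andP; split.
  have -> : m = size (traject f x m) by rewrite size_traject.
  apply: order_le_cycle; last by case: m m_gt0 {iter_eq} => //= m _; rewrite inE eqxx.
  case: m m_gt0 iter_eq => //= m _ iter_eq.
  rewrite rcons_path fpath_traject /= last_traject.
  by have := iter_eq m.+1; rewrite dvdnn => /= ->.
by apply: dvdn_leq; rewrite ?order_gt0 // -iter_eq iter_order.
Qed.

(** On a finite type an injective [f] has a power as its inverse, so an arc used backwards can be
    replaced by a forward path. *)
Lemma component_fgraph (T : finType) (f : T -> T) x :
  injective f -> component_verts (fgraph_arcs f) x = [set y in orbit f x].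
Proof.
move=> f_inj; apply/setP => y; rewrite !inE -fconnect_orbit.
apply/idP/idP; apply: connect_sub => {x y} u v.
  rewrite /adjacent !in_fgraph_arcs => /orP[] /eqP ->; first exact: fconnect1.
  by rewrite fconnect_sym // fconnect1.
by move=> /eqP <-; apply: connect1; rewrite /adjacent in_fgraph_arcs eqxx.
Qed.

Lemma dicycle_factor_fgraph (T : finType) (e : rel T) (f : T -> T) l :
  injective f -> (forall x, e x (f x)) -> (forall x, order f x = l) ->
  dicycle_factor e l (fgraph_arcs f).
Proof.
move=> f_inj f_e f_order; split=> [|x].
  by apply/subsetP => _ /imsetP[x _ ->]; rewrite inE f_e.
exists (orbit f x); split; first exact: orbit_uniq.
- by rewrite size_orbit.
- exact: component_fgraph.
have nextE y : y \in orbit f x -> next (orbit f x) y = f y.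
  by move=> /(next_cycle (cycle_orbit f_inj x)) /eqP <-.
apply/setP => -[u v]; rewrite /component_arcs component_fgraph // !inE.
rewrite in_fgraph_arcs; apply/and3P/imsetP => [[/eqP-> /= u_x _] | [y y_x [-> ->]]].
  by exists u; rewrite ?nextE.
by rewrite nextE //= mem_orbit.
Qed.

(** * Layerwise translations and their orders *)

Section Shift.
Local Open Scope ring_scope.
Variables (V : zmodType) (X : finType) (enc : X -> V) (dec : V -> X).
Hypotheses (encK : cancel enc dec) (decK : cancel dec enc).
Variables (n : nat) (a : 'I_n -> V).

Definition shift (x : X * 'I_n) : X * 'I_n :=
  (dec (enc x.1 + a x.2), ordS x.2).

Lemma shift_inj : injective shift.
Proof.
move=> [g i] [h j] shift_eq.
have /= eq_ij := ordS_inj (congr1 snd shift_eq).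
move: (congr1 fst shift_eq); rewrite /= -eq_ij.
by move=> /(can_inj decK) /addIr /(can_inj encK) ->.
Qed.

Lemma val_iter_ordS k (i : 'I_n) : iter k (@ordS n) i = ((i + k) %% n)%N :> nat.
Proof.
elim: k => [|k IHk]; first by rewrite addn0 modn_small.
by rewrite iterS /= IHk -addn1 modnDml addn1 addnS.
Qed.

Lemma iter_ordS_eq k (i : 'I_n) : (iter k (@ordS n) i == i) = (n %| k)%N.
Proof.
rewrite -val_eqE /= val_iter_ordS -[X in _ == X](@modn_small i n) //.
by rewrite -[X in _ == X %[mod _]]addn0 eqn_modDl mod0n.
Qed.

Lemma iter_shift k x :
  iter k shift x =
    (dec (enc x.1 + \sum_(t < k) a (iter t (@ordS n) x.2)), iter k (@ordS n) x.2).
Proof.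
elim: k => [|k IHk]; first by rewrite big_ord0 addr0 encK; case: x.
by rewrite iterS IHk /shift /= decK big_ord_recr /= addrA.
Qed.

(** A full turn meets every layer once, so its total translation does not depend on the starting
    layer. *)
Lemma sum_iter_ordS (i : 'I_n) :
  \sum_(t < n) a (iter t (@ordS n) i) = \sum_t a t.
Proof.
rewrite [RHS](reindex (fun t : 'I_n => iter t (@ordS n) i)) //=.
apply/onW_bij/injF_bij => s t /(congr1 (@nat_of_ord n)); rewrite !val_iter_ordS => /eqP.
by rewrite eqn_modDl !modn_small // => /eqP/val_inj.
Qed.

Lemma iter_shift_mul q x :
  iter (q * n)%N shift x = (dec (enc x.1 + (\sum_i a i) *+ q), x.2).
Proof.
elim: q => [|q IHq]; first by rewrite addr0 encK; case: x.
rewrite mulSn iterD IHq iter_shift /= decK sum_iter_ordS mulrSr addrA.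
by congr (_, _); apply/eqP; rewrite iter_ordS_eq.
Qed.

(** The hypothesis says that the total translation has additive order [l]. A return to the same
    layer takes a multiple of [n] steps, and after [q] turns the vertex is moved by [q] times that
    total. *)
Lemma order_shift l x :
  (0 < l)%N -> (forall q, ((\sum_i a i) *+ q == 0) = (l %| q)%N) ->
  order shift x = (l * n)%N.
Proof.
move=> l_gt0 sum_order; have n_gt0: (0 < n)%N by case: x => _ []; case: n.
apply: order_eq => [||k]; first exact: shift_inj.
  by rewrite muln_gt0 l_gt0.
have [/dvdnP[q ->]|n_k] := boolP (n %| k)%N.
  rewrite dvdn_pmul2r // -sum_order iter_shift_mul -pair_eqE /= eqxx andbT.
  by rewrite (can2_eq decK encK) -[X in _ == X]addr0 (inj_eq (addrI _)).
rewrite iter_shift -pair_eqE /= iter_ordS_eq (negPf n_k) andbF.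
by apply/esym/negbTE/(contra _ n_k); apply: dvdn_trans; apply: dvdn_mull.
Qed.

End Shift.

(** * Partition of the arcs into translation digraphs *)

Section ShiftFactorization.
Local Open Scope ring_scope.
Variables (V : zmodType) (x n : nat) (enc : 'I_x -> V) (dec : V -> 'I_x).
Hypotheses (encK : cancel enc dec) (decK : cancel dec enc).
Variables (J : finType) (a : J -> 'I_n -> V).
Hypotheses (x_gt0 : (0 < x)%N) (n_gt0 : (0 < n)%N).
Hypothesis a_bij : forall i, bijective (a^~ i).

Definition shift_arcs (j : J) := fgraph_arcs (shift enc dec (a j)).

Lemma in_shift_arcs j g i h k :
  (((g, i), (h, k)) \in shift_arcs j) = (k == ordS i) && (a j i == enc h - enc g).
Proof.
rewrite in_fgraph_arcs -pair_eqE /= andbC (eq_sym h) (can2_eq decK encK).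
by rewrite addrC [a j i == _]eq_sym subr_eq [enc h == _]eq_sym.
Qed.

(** An arc from [(g, i)] to [h] in the next layer lies in class [j] exactly when
    [a j i = enc h - enc g], and bijectivity in [j] leaves one such class. *)
Lemma shift_arcs_partition :
  partition (shift_arcs @: [set: J]) (arcs (blowup_cycle x n)) /\
  injective shift_arcs.
Proof.
have [|j _|part inj] := @indexed_partition _ _ [set: J] shift_arcs; last 1 first.
- split; last by move=> j k; apply: inj; rewrite inE.
  suff <- : cover (shift_arcs @: [set: J]) = arcs (blowup_cycle x n) by [].
  apply/setP => -[[g i] [h k]]; rewrite cover_imset !inE /blowup_cycle /=.
  apply/bigcupP/idP => [[j _]|k_i]; first by rewrite in_shift_arcs => /andP[].
  have [b _ bK] := a_bij i; exists (b (enc h - enc g)) => //.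
  by rewrite in_shift_arcs k_i bK eqxx.
- move=> j k _ _; apply: contraR => /pred0Pn[[[g i] [h l]]] /andP[/=].
  rewrite !in_shift_arcs => /andP[_ /eqP j_eq] /andP[_ /eqP k_eq].
  by apply/eqP/(bij_inj (a_bij i)); rewrite j_eq k_eq.
(* A partition has no empty block, so each class must exhibit an arc. *)
apply/set0Pn; pose u := (Ordinal x_gt0, Ordinal n_gt0).
by exists (u, shift enc dec (a j) u); rewrite in_fgraph_arcs.
Qed.

Lemma shift_arcs_factor l j :
  (0 < l)%N -> (forall q, ((\sum_i a j i) *+ q == 0) = (l %| q)%N) ->
  dicycle_factor (blowup_cycle x n) (l * n) (shift_arcs j).
Proof.
move=> l_gt0 sum_order; apply: dicycle_factor_fgraph.
- exact: shift_inj.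
- by move=> u; apply: eqxx.
by move=> u; apply: order_shift.
Qed.

End ShiftFactorization.

(** * Permutations of the Klein four-group *)

Section Klein.
Local Open Scope ring_scope.
Let V : zmodType := (bool * bool)%type.

Lemma klein_mulr2n (v : V) : v *+ 2 = 0.
Proof. by case: v => [] [] []. Qed.

Lemma klein_mulrn (v : V) m : v *+ m = if odd m then v else 0.
Proof.
rewrite -[in LHS](odd_double_half m) mulrnDr -muln2 mulnC mulrnA klein_mulr2n.
by rewrite mul0rn addr0; case: odd.
Qed.

(** The value 1 is impossible: the sum of [v + u v] over all [v] is 0, so exactly one nonzero term
    cannot occur. *)
Lemma klein_perm_support s : s \in [:: 0; 2; 3; 4]%N ->
  exists2 u : V -> V, injective u &
    #|[set v : bool * bool | v + u v != 0 :> V]| = s.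
Proof.
have card_supp (A : {set bool * bool}) :
    #|A| = (((true, true) \in A) + ((true, false) \in A)
           + ((false, true) \in A) + ((false, false) \in A))%N.
  rewrite -sum1_card big_mkcond (eq_bigr (fun v => (v.1, v.2) \in A : nat)) => [|[]//].
  by rewrite -(pair_bigA _ (fun x y => (x, y) \in A : nat)) !big_bool /= addnA.
rewrite !inE => /or4P[] /eqP->.
(* In the four cases [v + u v] is 0, [(0, v.1)], an invertible linear function of [v], and the
   constant [(0, 1)]. *)
- by exists id => //; rewrite card_supp !inE.
- exists (fun v => (v.1, v.1 (+) v.2)); last by rewrite card_supp !inE.
  by move=> [[] []] [[] []].
- exists (fun v => (v.2, v.1 (+) v.2)); last by rewrite card_supp !inE.
  by move=> [[] []] [[] []].
exists (fun v => (v.1, ~~ v.2)); last by rewrite card_supp !inE.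
by move=> [[] []] [[] []].
Qed.

(** The term depending on [o] is the contribution of the layers from 2 on. When it is [v], a linear
    bijection [M] with [M (M v) = M v + v] absorbs it: with [w = M (M v)] the sum becomes [w + u w],
    and [w] runs over the whole group. *)
Lemma klein_levels (o : bool) s : s \in [:: 0; 2; 3; 4]%N ->
  exists p q : V -> V, [/\ injective p, injective q &
    #|[set v : bool * bool | p v + (q v + (if o then v else 0)) != 0 :> V]| = s].
Proof.
case/klein_perm_support => u u_inj <-; case: o; last first.
  by exists id, u; split=> //; apply: eq_card => v; rewrite !inE addr0.
(* Multiplication by a generator of the multiplicative group of the field with four elements. *)
pose M (v : V) : V := (v.2, v.1 (+) v.2).
have M_inj : injective M by move=> [[] []] [[] []].
have MMD v : M (M v) = M v + v by case: v => [] [] [].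
exists M, (u \o M \o M); split=> //.
  by do 2![apply: inj_comp => //].
rewrite -[RHS](card_preimset _ (inj_comp M_inj M_inj)).
by apply: eq_card => v; rewrite !inE /= [X in M v + X]addrC addrA -MMD.
Qed.

End Klein.

Theorem theorem6p9 (n s : nat) (hn : 3 <= n) (hs : s \in [:: 0; 2; 3; 4]) :
  exists P Q : {set {set ('I_4 * 'I_n) * ('I_4 * 'I_n)}},
    [/\ #|P| = s /\ (forall F, F \in P -> dicycle_factor (blowup_cycle 4 n) (2 * n) F),
        #|Q| = 4 - s /\ (forall F, F \in Q -> dicycle_factor (blowup_cycle 4 n) n F),
        [disjoint P & Q]
      & partition (P :|: Q) (arcs (blowup_cycle 4 n))].
Proof.
have card4 : 4 = #|{: bool * bool}| by rewrite card_prod card_bool.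
pose enc g := enum_val (cast_ord card4 g).
pose dec v := cast_ord (esym card4) (enum_rank v).
have encK : cancel enc dec by move=> g; rewrite /dec enum_valK cast_ordK.
have decK : cancel dec enc by move=> v; rewrite /enc cast_ordKV enum_rankK.
have [p [q [p_inj q_inj card_s]]] := klein_levels (odd n) hs.
pose a (v : bool * bool) (i : 'I_n) :=
  if i == 0 :> nat then p v else if i == 1 :> nat then q v else v.
have a_bij i : bijective (a^~ i).
  by apply: injF_bij; rewrite /a; case: eqP => // _; case: eqP => // _ ? ?.
have sum_a v : (\sum_i a v i = p v + (q v + if odd n then v else 0))%R.
  rewrite /a; case: n hn {a a_bij card_s} => [|[|m]] // _; rewrite !big_ord_recl /=.
  (* Here [n] is [m.+2]: the last [m] layers give [v *+ m], and [odd m.+2] is a double negation of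
     [odd m]. *)
  by rewrite sumr_const card_ord klein_mulrn negbK.
have n_gt0 : 0 < n by apply: leq_trans hn.
have [part F_inj] := shift_arcs_partition encK decK (isT : 0 < 4) n_gt0 a_bij.
set F := shift_arcs _ _ _ in part F_inj.
pose B := [set v | (\sum_i a v i != 0)%R].
have cardB : #|B| = s by rewrite -card_s; apply: eq_card => v; rewrite !inE sum_a.
exists (F @: B), (F @: ~: B); split.
- split=> [|_ /imsetP[v + ->]]; first by rewrite card_imset.
  (* Every nonzero element of the group has order 2. *)
  rewrite inE => b_neq0; apply: shift_arcs_factor => // k.
  by rewrite klein_mulrn dvdn2; case: odd; rewrite ?eqxx ?(negPf b_neq0).
- split=> [|_ /imsetP[v + ->]].
    by rewrite card_imset // cardsCs setCK cardB card_prod card_bool.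
  rewrite !inE negbK => /eqP b_eq0; rewrite -[X in dicycle_factor _ X]mul1n.
  by apply: shift_arcs_factor => // k; rewrite b_eq0 mul0rn eqxx dvd1n.
- by rewrite imset_disjoint // -setI_eq0 setICr.
by rewrite -imsetU setUCr.
Qed.
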